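(* Let $pod_2(n)$ be defined by $\sum_{n\ge 0} pod_2(n)q^n = \frac{\psi(-q^2)}{\psi(-q)} = \frac{f_2^2 f_8}{f_1 f_4^2}$, and let $\tau(n)$ be Ramanujan's tau function. Let $p$ be an odd prime. Then: (i) Suppose $s$ is an integer with $1\le s\le 8p$, $s\equiv 1 \pmod 8$ and $\left(\frac{s}{p}\right) = -1$ (Legendre symbol). Then for all $n\ge 0$, $$pod_2\!\left(pn + \frac{s-1}{8}\right)\equiv 0 \pmod 2.$$ If moreover $\tau(p)\equiv 0 \pmod 2$, then for all $n\ge 0$ and $k\ge 1$, $$pod_2\!\left(p^{2k+1}n + \frac{sp^{2k}-1}{8}\right)\equiv 0 \pmod 2.$$ (ii) Suppose $r$ is an integer with $1\le r\le 8p$, $rp\equiv 1 \pmod 8$ and $\gcd(r,p)=1$. If $\tau(p)\equiv 0\pmod 2$, then for all $n\ge 0$ and $k\ge 1$, $$pod_2\!\left(p^{2k+2}n + \frac{rp^{2k+1}-1}{8}\right)\equiv 0 \pmod 2.$$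
   Context: For $|q|<1$ and integers $j\ge 1$, $f_j := \prod_{n=1}^{\infty}(1-q^{jn})$. Ramanujan's theta function is $\psi(q) := \sum_{n=0}^{\infty} q^{n(n+1)/2} = f_2^2/f_1$, so that $\psi(-q) = f_1f_4/f_2$. The paper describes $pod_2(n)$ as the number of $2$-regular partitions of $n$ with distinct odd parts (even parts unrestricted), with generating function $\sum_{n\ge0} pod_2(n)q^n = \psi(-q^2)/\psi(-q)$. Ramanujan's tau function is defined by $\Delta(z) = q\prod_{n=1}^{\infty}(1-q^n)^{24} = \sum_{n=1}^{\infty}\tau(n)q^n$. *)

(* Defs.v *)
From HB Require Import structures.
From mathcomp Require Import all_boot all_order all_algebra.
Set Implicit Arguments.
Unset Strict Implicit.
Unset Printing Implicit Defensive.
Import Order.TTheory GRing.Theory Num.Theory.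
Local Open Scope ring_scope.

(* All q-series are read as formal power series over int, a series being its  *)
(* sequence of coefficients.                                                  *)
Definition fps := nat -> int.

Definition fps_mul (a b : fps) : fps :=
  fun n => \sum_(i < n.+1) a i * b (n - i)%N.

(* The first n.+1 coefficients b_0, ..., b_n of 1/a, computed from            *)
(*   b_0 = 1/a_0  and  b_n = - (1/a_0) \sum_(i < n) a_(n - i) b_i.            *)
Fixpoint fps_inv_seq (a : fps) (n : nat) : seq int :=
  if n is m.+1 then
    let s := fps_inv_seq a m in
    rcons s (- (a 0%N)^-1 * \sum_(i < m.+1) a (m.+1 - i)%N * s`_i)
  else [:: (a 0%N)^-1].

(* Meaningful only when a 0 is a unit of int; see fps_mulV.                   *)
Definition fps_inv (a : fps) : fps := fun n => (fps_inv_seq a n)`_n.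

Definition fps_div (a b : fps) : fps := fps_mul a (fps_inv b).

(* The series a(c q^j), for j >= 1.                                           *)
Definition fps_subst (c : int) (j : nat) (a : fps) : fps :=
  fun n => if (j %| n)%N then c ^+ (n %/ j) * a (n %/ j)%N else 0.

(* \sum_(k >= 0) q^(k(k+1)/2); only k <= n can contribute to q^n.             *)
Definition psi : fps :=
  fun n => \sum_(k < n.+1 | ((k * k.+1) %/ 2 == n)%N) 1.

(* psi(-q^2) / psi(-q) *)
Definition pod2 : fps :=
  fps_div (fps_subst (-1) 2 psi) (fps_subst (-1) 1 psi).

(* The coefficient of q^n in q \prod_(m >= 1) (1 - q^m)^24; the factors with  *)
(* m > n do not affect it, see tau_trunc.                                     *)
Definition tau (n : nat) : int :=
  ('X * \prod_(1 <= m < n.+1) (1 - 'X^m) ^+ 24 : {poly int})`_n.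

(* The Legendre symbol (a/p), for p an odd prime.                             *)
Definition legendre (a : int) (p : nat) : int :=
  if a%:~R == 0 :> 'F_p then 0
  else if [exists x : 'F_p, x ^+ 2 == a%:~R] then 1 else -1.

Lemma size_fps_inv_seq a n : size (fps_inv_seq a n) = n.+1.
Proof. by elim: n => //= n IH; rewrite size_rcons IH. Qed.

Lemma nth_fps_inv_seq a n i : (i <= n)%N -> (fps_inv_seq a n)`_i = fps_inv a i.
Proof.
elim: n => [|n IH]; first by rewrite leqn0 => /eqP->.
rewrite leq_eqVlt => /orP[/eqP-> //|le_in] /=.
by rewrite nth_rcons size_fps_inv_seq le_in IH.
Qed.

Lemma fps_inv0 a : fps_inv a 0 = (a 0%N)^-1.
Proof. by []. Qed.

Lemma fps_invS a n :
  fps_inv a n.+1 = - (a 0%N)^-1 * \sum_(i < n.+1) a (n.+1 - i)%N * fps_inv a i.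
Proof.
rewrite {1}/fps_inv /= nth_rcons size_fps_inv_seq ltnn eqxx.
congr (_ * _); apply: eq_bigr => i _.
by rewrite nth_fps_inv_seq // -ltnS.
Qed.

Lemma fps_mulV a n :
  a 0%N \is a GRing.unit -> fps_mul (fps_inv a) a n = (n == 0%N)%:R.
Proof.
move=> Ua; rewrite /fps_mul; case: n => [|n].
  by rewrite big_ord_recr big_ord0 /= add0r mulVr.
rewrite big_ord_recr /= subnn fps_invS mulNr mulNr mulrAC mulVr // mul1r.
under eq_bigr do rewrite mulrC.
by rewrite subrr.
Qed.

Lemma pod2_denom_unit : fps_subst (-1) 1 psi 0%N \is a GRing.unit.
Proof.
by rewrite /fps_subst /psi big_mkcond big_ord_recr big_ord0 /= unitr1.
Qed.

Lemma tau_trunc n N : (n <= N)%N ->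
  ('X * \prod_(1 <= m < N.+1) (1 - 'X^m) ^+ 24 : {poly int})`_n = tau n.
Proof.
rewrite /tau; move: 24%N => e.
elim: N => [|N IH]; first by rewrite leqn0 => /eqP->.
rewrite leq_eqVlt => /orP[/eqP-> //|]; rewrite ltnS => le_nN.
rewrite -(IH le_nN).
have [u Du] : exists u : {poly int}, (1 - 'X^(N.+1)) ^+ e = 1 + u * 'X^(N.+1).
  elim: e {IH} => [|k [u IHk]]; first by exists 0; rewrite mul0r addr0 expr0.
  exists (u - 1 - u * 'X^(N.+1)).
  by rewrite exprSr IHk mulrBr mulr1 mulrDl !mulrBl !mul1r opprD !addrA (addrAC 1).
rewrite big_nat_recr //= Du mulrA mulrDr mulr1 coefD mulrA coefMXn ltnS le_nN.
by rewrite addr0.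
Qed.

(* Main.v *)
Require Import Defs.
From mathcomp Require Import all_boot all_order all_algebra.
From mathcomp Require Import zify.
Import GRing.Theory.
Local Open Scope ring_scope.

(** Modulo 2 the sign in the argument of [psi] is invisible and the Frobenius
    map gives psi(q^2) = psi(q)^2, so that psi(-q^2) / psi(-q) = psi(q).
    Hence pod2 n is odd only if n is triangular, that is, if 8 n + 1 is a
    square.  Each progression of the theorem avoids this: 8 n + 1 is either an
    even power of p times a quadratic non-residue modulo p, or has odd p-adic
    valuation. *)

Lemma pchar_F2 : 2%N \in [pchar 'F_2].
Proof. exact: pchar_Fp. Qed.

Lemma sqr_F2 (x : 'F_2) : x ^+ 2 = x.
Proof. by case: x => [[|[|]]] // i; apply: val_inj. Qed.

Lemma intr_F2_eq0 (m : int) : m%:~R = 0 :> 'F_2 -> (m = 0 %[mod 2])%Z.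
Proof.
move=> m0; apply/eqP; rewrite eqz_mod_dvd subr0 dvdzE /= (dvdn_pcharf pchar_F2).
case: m m0 => n; first by move/eqP.
by rewrite NegzE mulrNz => /eqP; rewrite oppr_eq0.
Qed.

(** Squaring is the Frobenius morphism, hence additive, and it fixes the coefficients in ['F_2]; so
    P(X)^2 = P(X^2), by induction on the Horner form P X + c. *)
Lemma coef_sqr_F2 (P : {poly 'F_2}) m :
  (P ^+ 2)`_m = if (2 %| m)%N then P`_(m %/ 2) else 0.
Proof.
have pcharP : 2%N \in [pchar {poly 'F_2}] by rewrite pchar_poly pchar_F2.
elim/poly_ind: P m => [|P c IH] m; first by rewrite expr0n !coef0 if_same.
rewrite -!(pFrobenius_autE pcharP) rmorphD rmorphM /= !pFrobenius_autE.
rewrite -rmorphXn /= sqr_F2 coefD coefMXn coefC IH coefD coefMX coefC.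
case: m => [|[|m]]; rewrite ?addr0 ?add0r // subSS subSS subn0.
rewrite (_ : (2 %| m.+2)%N = (2 %| m)%N); last by lia.
rewrite (_ : (m.+2 %/ 2 = (m %/ 2).+1)%N); last by lia.
by rewrite addr0.
Qed.

(** Passing to polynomials gives access to ring laws and Frobenius. Coefficients of a product up to
    degree n depend only on those of the factors up to degree n, so truncation loses nothing
    there. *)
Definition trunc_F2 (n : nat) (a : fps) : {poly 'F_2} :=
  \poly_(i < n.+1) (a i)%:~R.

Lemma coef_trunc_F2 n a i : (i <= n)%N -> (trunc_F2 n a)`_i = (a i)%:~R.
Proof. by move=> le_in; rewrite coef_poly ltnS le_in. Qed.

Lemma coef_truncM_F2 n a b i : (i <= n)%N ->
  (trunc_F2 n a * trunc_F2 n b)`_i = (fps_mul a b i)%:~R.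
Proof.
move=> le_in; rewrite coefM rmorph_sum /=; apply: eq_bigr => j _.
rewrite !coef_trunc_F2 ?rmorphM //=; first by lia.
by apply: leq_trans le_in; rewrite -ltnS.
Qed.

Lemma fps_mulC a b n : fps_mul a b n = fps_mul b a n.
Proof.
rewrite /fps_mul (reindex_inj rev_ord_inj) /=; apply: eq_bigr => i _.
by rewrite mulrC subSS subKn // -ltnS.
Qed.

Lemma coefM_eql (R : nzRingType) (n : nat) (P Q T : {poly R}) :
  (forall i, (i <= n)%N -> P`_i = Q`_i) -> (P * T)`_n = (Q * T)`_n.
Proof.
move=> eqPQ; rewrite !coefM; apply: eq_bigr => i _.
by rewrite eqPQ // -ltnS.
Qed.

Lemma signr_F2 (k : nat) (m : int) : ((-1) ^+ k * m)%:~R = m%:~R :> 'F_2.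
Proof.
rewrite rmorphM rmorphXn rmorphN1 /=.
by rewrite (_ : -1 = 1 :> 'F_2) ?expr1n ?mul1r //; apply: val_inj.
Qed.

Lemma pod2_mod2 n : (pod2 n)%:~R = (psi n)%:~R :> 'F_2.
Proof.
set S := trunc_F2 n psi.
set I := trunc_F2 n (fps_inv (fps_subst (-1) 1 psi)).
rewrite /pod2 /fps_div -(@coef_truncM_F2 n) // -/I.
(* Up to degree n, the numerator psi(-q^2) agrees with [S ^+ 2]. *)
rewrite (@coefM_eql _ _ _ (S ^+ 2)); last first.
  move=> i le_in; rewrite coef_sqr_F2 coef_trunc_F2 // /fps_subst.
  case: ifP => // _; rewrite signr_F2 coef_trunc_F2 //.
  exact: leq_trans (leq_div _ _) le_in.
have SE : S = trunc_F2 n (fps_subst (-1) 1 psi).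
  apply/polyP => i; rewrite !coef_poly; case: ifP => // _.
  by rewrite /fps_subst dvd1n divn1 signr_F2.
(* Regroup as S (S I): by [SE], S also truncates the denominator, so S I is 1 up to degree n and
   only S remains. *)
rewrite expr2 -mulrA mulrC (@coefM_eql _ _ _ 1).
  by rewrite mul1r coef_trunc_F2.
move=> i le_in; rewrite SE coef_truncM_F2 // fps_mulC fps_mulV ?pod2_denom_unit //.
by rewrite coef1; case: (i == _).
Qed.

Lemma psi_neq0 n : psi n != 0 -> exists m, (8 * n + 1 = m ^ 2)%N.
Proof.
rewrite /psi; case: (pickP (fun k : 'I_n.+1 => (k * k.+1) %/ 2 == n)%N).
  (* 8 k(k+1)/2 + 1 = (2k+1)^2; the halving is exact because k(k+1) is even. *)
  move=> k /eqP kE _; exists (2 * k + 1)%N.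
  have : (2 %| k * k.+1)%N by rewrite dvdn2 oddM /= andbN.
  by move/divnK; rewrite kE; nia.
by move=> no_k; rewrite big_pred0 ?eqxx.
Qed.

Lemma pod2_even n : (forall m, (8 * n + 1 <> m ^ 2)%N) -> (pod2 n = 0 %[mod 2])%Z.
Proof.
move=> nsq; apply: intr_F2_eq0; rewrite pod2_mod2.
by have [-> //|/psi_neq0[m /nsq]] := eqVneq (psi n) 0.
Qed.

(** The term 8pn vanishes in ['F_p], so m would be a square root of s there. *)
Lemma legendreN1_neq_sqr p s n m :
  prime p -> legendre s%:Z p = -1 -> (8 * p * n + s <> m ^ 2)%N.
Proof.
move=> p_pr; rewrite /legendre; case: eqP => // _; case: existsP => // nsq _ E.
case: nsq; exists m%:R; rewrite -natrX -E natrD -mulnA mulnCA natrM.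
by rewrite pchar_Fp_0 // mul0r add0r.
Qed.

(** Odd squares are 1 modulo 8. This makes the divisions by 8 in the indices of the progressions
    exact. *)
Lemma modn8_odd_exp2 p k : odd p -> (p ^ (2 * k) = 1 %[mod 8])%N.
Proof.
move=> p_odd; rewrite expnM -modnXm.
suff -> : (p ^ 2 %% 8 = 1)%N by rewrite exp1n.
rewrite -modnXm.
have : odd (p %% 8) by rewrite odd_mod.
have : (p %% 8 < 8)%N by rewrite ltn_mod.
by case: (p %% 8)%N => [|[|[|[|[|[|[|[|]]]]]]]].
Qed.

Lemma mul8_divn8_pred a : (a = 1 %[mod 8])%N -> (8 * ((a - 1) %/ 8) + 1 = a)%N.
Proof. by lia. Qed.

Theorem theorem1p3 (p : nat) (p_prime : prime p) (p_odd : odd p) :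
  (forall s : nat,
      (1 <= s <= 8 * p)%N -> (s = 1 %[mod 8])%N -> legendre s%:Z p = -1 ->
      (forall n : nat,
          (pod2 (p * n + (s - 1) %/ 8)%N = 0 %[mod 2])%Z)
      /\
      ((tau p = 0 %[mod 2])%Z ->
       forall n k : nat, (1 <= k)%N ->
          (pod2 (p ^ (2 * k + 1) * n + (s * p ^ (2 * k) - 1) %/ 8)%N
             = 0 %[mod 2])%Z))
  /\
  (forall r : nat,
      (1 <= r <= 8 * p)%N -> (r * p = 1 %[mod 8])%N -> gcdn r p = 1%N ->
      (tau p = 0 %[mod 2])%Z ->
      forall n k : nat, (1 <= k)%N ->
         (pod2 (p ^ (2 * k + 2) * n + (r * p ^ (2 * k + 1) - 1) %/ 8)%N
            = 0 %[mod 2])%Z).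
Proof.
split=> [s _ s8 sN|r _ r8 r_p _ n k _].
  split=> [n|_ n k _]; apply: pod2_even => m.
    rewrite mulnDr -addnA mul8_divn8_pred // mulnA.
    exact: legendreN1_neq_sqr.
  have pk8 : (s * p ^ (2 * k) = 1 %[mod 8])%N.
    by rewrite -modnMm s8 modn8_odd_exp2.
  rewrite mulnDr -addnA mul8_divn8_pred // => E.
  have pk_gt0 : (0 < p ^ k)%N by rewrite expn_gt0 prime_gt0.
  (* Factor p^(2k) out of 8N + 1, N being the index; cancelling it as a square reduces to the first
     progression. *)
  have {}E : ((p ^ k) ^ 2 * (8 * p * n + s) = m ^ 2)%N.
    by rewrite -E -expnM (mulnC k) addn1 expnSr; nia.
  have /dvdnP[t mE] : (p ^ k %| m)%N.
    by rewrite -(@dvdn_pexp2r _ _ 2) // -E dvdn_mulr.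
  apply: (@legendreN1_neq_sqr p s n t) => //; apply/eqP.
  have pk2_gt0 : (0 < (p ^ k) ^ 2)%N by rewrite expn_gt0 pk_gt0.
  by rewrite -(eqn_pmul2l pk2_gt0) E mE expnMn mulnC.
apply: pod2_even => m.
have rpk8 : (r * p ^ (2 * k + 1) = 1 %[mod 8])%N.
  by rewrite addn1 expnS mulnA -modnMm r8 modn8_odd_exp2.
rewrite mulnDr -addnA mul8_divn8_pred // => E.
have {}E : (p ^ (2 * k + 1) * (8 * p * n + r) = m ^ 2)%N.
  by rewrite -E addn2 addn1 (expnS _ (_.+1)); nia.
(* The cofactor is prime to p, so the left side of [E] has p-adic valuation exactly 2k+1. *)
have p_ndvd : ~~ (p %| 8 * p * n + r)%N.
  rewrite dvdn_addr; last by rewrite mulnAC dvdn_mull.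
  by rewrite -prime_coprime // coprime_sym /coprime r_p.
(* [logn] takes the default value 0 at 0, so its additivity on products requires positive
   factors. *)
have pos : (0 < 8 * p * n + r)%N.
  by case: (8 * p * n + r)%N p_ndvd => //; rewrite dvdn0.
(* Compare parities of valuations: odd on the left, even for the square m^2. *)
have := congr1 (fun x => odd (logn p x)) E.
have ppow_gt0 : (0 < p ^ (2 * k + 1))%N by rewrite expn_gt0 prime_gt0.
rewrite lognM // !lognX logn_prime // eqxx.
by rewrite (logn_coprime (m := (8 * p * n + r)%N)) ?prime_coprime //
   muln1 addn0 oddD !oddM.
Qed.
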